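(* For the constrained optimization problem $\max_{\mathbf{x}} f(\mathbf{x},\mathbf{a})$ subject to $g^k(\mathbf{x},\mathbf{a})=0$, $k=1,\dots,K$, with solution $\mathbf{x}(\mathbf{a})$ as described in the context, the $N\times N$ matrix $$U_{\mu\nu}(\mathbf{a})=\sum_{i,j=1}^{M}x_{i,\mu}(\mathbf{a})\,[I-Q]_{ij}\Big\{L_{,j\nu}-\sum_{l=1}^{M}L_{,jl}\sum_{k,k'=1}^{K}g^{k}_{,l}\,\mathcal{G}^{-1}_{kk'}\,g^{k'}_{,\nu}\Big\},$$ with $Q,L_{,j\nu},L_{,jl},g^k_{,l},\mathcal{G}^{-1},g^{k'}_{,\nu}$ all evaluated at $(\mathbf{x}(\mathbf{a}),\mathbf{a})$, is, free of constraints, a symmetric positive semidefinite matrix (a comparative statics matrix) for every $\mathbf{a}\in\mathcal{P}$. Moreover $\operatorname{rank}U\le\min(M-K,N)$.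
   Context: Setting. $\mathcal{P}\subset\mathbb{R}^N$ is open (parameter space), $\mathcal{D}\subset\mathbb{R}^M$ (decision space), $M,N>K$, and $f,g^1,\dots,g^K$ are real-valued functions of $(\mathbf{x},\mathbf{a})$, twice continuously differentiable on an open set containing $\mathcal{D}\times\mathcal{P}$. For each $\mathbf{a}\in\mathcal{P}$ consider $\max_{\mathbf{x}\in\mathcal{D}} f(\mathbf{x},\mathbf{a})$ subject to $g^k(\mathbf{x},\mathbf{a})=0$, $k=1,\dots,K$. It is assumed that there is a continuously differentiable function $\mathbf{x}(\cdot):\mathcal{P}\to\mathcal{D}$ such that for each $\mathbf{a}\in\mathcal{P}$ the point $\mathbf{x}(\mathbf{a})$ lies in the interior of $\mathcal{D}$ and is the unique solution of the problem. The constraints are independent at the solution: the $K$ decision-space gradients $(g^k_{,i}(\mathbf{x}(\mathbf{a}),\mathbf{a}))_{i=1}^M$ are linearly independent. Notation. Latin subscripts $i,j,l$ after a comma are partial derivatives with respect to decision variables, Greek subscripts $\mu,\nu$ after a comma partial derivatives with respect to parameters; $x_{i,\mu}=\partial x_i(\mathbf{a})/\partial a_\mu$. The multipliers $\lambda_k(\mathbf{a})$ are the scalars with $f_{,i}+\sum_k\lambda_k g^k_{,i}=0$ at $(\mathbf{x}(\mathbf{a}),\mathbf{a})$. The symbols $L_{,ij}=f_{,ij}+\sum_k\lambda_k g^k_{,ij}$ and $L_{,j\nu}=f_{,j\nu}+\sum_k\lambda_k g^k_{,j\nu}$ are second partial derivatives of the Lagrange function $L=f+\sum_k\lambda_k g^k$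 with the multipliers held fixed. $\mathcal{G}_{kk'}=\sum_{i=1}^M g^k_{,i}g^{k'}_{,i}$ is the (invertible) $K\times K$ Gram matrix, $Q_{ij}=\sum_{k,k'=1}^K g^k_{,i}\,\mathcal{G}^{-1}_{kk'}\,g^{k'}_{,j}$ is the orthogonal projection onto the span of the decision-space gradients of the constraints, and $I$ is the $M\times M$ identity matrix. *)

(* Defs.v *)
From mathcomp Require Export all_boot all_order all_algebra.
From mathcomp Require Export all_classical all_reals all_analysis.
Export Order.TTheory GRing.Theory Num.Theory.
Export numFieldNormedType.Exports.

Set Implicit Arguments.
Unset Strict Implicit.
Unset Printing Implicit Defensive.

Local Open Scope classical_set_scope.
Local Open Scope ring_scope.

(* In finite dimension, continuity of every directional derivative is
   continuity of the Frechet derivative in operator norm. *)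
Definition C1_on (R : realType) (V W : normedModType R) (A : set V)
    (h : V -> W) : Prop :=
  forall z, A z ->
    differentiable h z /\ forall v : V, {for z, continuous ('D_v h)}.

Definition C2_on (R : realType) (V W : normedModType R) (A : set V)
    (h : V -> W) : Prop :=
  C1_on A h /\ forall v : V, C1_on A ('D_v h).

Definition psdmx (R : realType) (n : nat) (A : 'M[R]_n) : Prop :=
  A^T = A /\ forall v : 'rV[R]_n, 0 <= (v *m A *m v^T) 0 0.

Section Problem.
Variables (R : realType) (M N K : nat).

(* Points are pairs z = (x, a); functions are total, and only their values
   near D `*` P matter. *)
Local Notation point := ('rV[R]_M * 'rV[R]_N)%type.

Definition d_dx (h : point -> R) (i : 'I_M) : point -> R :=
  'D_((delta_mx 0 i, 0) : point) h.

Definition d_da (h : point -> R) (mu : 'I_N) : point -> R :=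
  'D_((0, delta_mx 0 mu) : point) h.

Variables (f : point -> R) (g : 'I_K -> point -> R).

Definition feasible (D : set 'rV[R]_M) (a : 'rV[R]_N) : set 'rV[R]_M :=
  [set y | D y /\ forall k, g k (y, a) = 0].

Definition is_solution (D : set 'rV[R]_M) (a : 'rV[R]_N) (y : 'rV[R]_M) :=
  feasible D a y /\ forall y', feasible D a y' -> f (y', a) <= f (y, a).

Definition constraint_grad (z : point) : 'M[R]_(K, M) :=
  \matrix_(k < K, i < M) d_dx (g k) i z.

Definition Gram (z : point) : 'M[R]_K :=
  \matrix_(k < K, k' < K) \sum_(i < M) d_dx (g k) i z * d_dx (g k') i z.

Definition Gram_inv (z : point) : 'M[R]_K := invmx (Gram z).

Definition Qproj (z : point) : 'M[R]_M :=
  \matrix_(i < M, j < M) \sum_(k < K) \sum_(k' < K)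
    d_dx (g k) i z * Gram_inv z k k' * d_dx (g k') j z.

Definition is_multiplier (z : point) (lam : 'rV[R]_K) : Prop :=
  forall i : 'I_M, d_dx f i z + \sum_(k < K) lam 0 k * d_dx (g k) i z = 0.

(* Definite description: a default value is returned when no multiplier
   exists. *)
Definition multiplier (z : point) : 'rV[R]_K :=
  get [set lam | is_multiplier z lam].

(* Second derivatives of the Lagrange function f + \sum_k lam_k g^k with the
   multipliers held fixed at their value at z. *)
Definition L_xx (z : point) (i j : 'I_M) : R :=
  d_dx (d_dx f i) j z
  + \sum_(k < K) multiplier z 0 k * d_dx (d_dx (g k) i) j z.

Definition L_xa (z : point) (j : 'I_M) (nu : 'I_N) : R :=
  d_da (d_dx f j) nu z
  + \sum_(k < K) multiplier z 0 k * d_da (d_dx (g k) j) nu z.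

Definition Umx (x : 'rV[R]_N -> 'rV[R]_M) (a : 'rV[R]_N) : 'M[R]_N :=
  let z := (x a, a) in
  \matrix_(mu < N, nu < N) \sum_(i < M) \sum_(j < M)
    'D_(delta_mx 0 mu) (fun b => x b 0 i) a
    * (1%:M - Qproj z) i j
    * (L_xa z j nu
       - \sum_(l < M) L_xx z j l *
           \sum_(k < K) \sum_(k' < K)
             d_dx (g k) l z * Gram_inv z k k' * d_da (g k') nu z).

End Problem.

(* Main.v *)
From HB Require Import structures.
From mathcomp Require Import ring lra.
Require Import Defs.

(** Write z = (x(a), a), J for the constraint gradients and G for the Gram
    matrix J J^T at z, H = L_xx, B = L_xa, Ja for the derivatives of the
    constraints in the parameters, X for the Jacobian of the solution,
    Q = J^T G^-1 J and S = I - Q.  The matrix of the theorem is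
    U = X^T S (B - H J^T G^-1 Ja).  Two identities simplify it.

    - Differentiating g^k(x(a), a) = 0 gives J X + Ja = 0, so that
      J^T G^-1 Ja = - Q X ([constraint_derivative]).
    - Differentiating the first-order condition f_i + sum_k lam_k g^k_i = 0
      formally in a gives H X + B = - J^T (derivative of lam), and the
      right-hand side is killed by every row p with p J^T = 0, such as the
      rows of S.  So S (H X + B) = 0 ([stationarity_derivative]).

    Hence S B = - S H X and U = - X^T S H S X.  This is symmetric because H
    is ([Schwarz]); it is positive semidefinite because H is negative
    semidefinite on the kernel of J, which contains the image of S
    ([second_order_condition]); and its rank is at most that of S, which is
    at most M - K because S J^T = 0.  The matrix computation is
    [comparative_statics_algebra].

    The analytic input is the pair of necessary conditions for a constrained
    maximum.  Both rest on one geometric fact, [tangent_direction]: every w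
    with J w^T = 0 is a limit of directions w' along which z + t w' stays on
    the constraint set for arbitrarily small t.  The correction w' - w solves
    a fixed-point equation for a contraction, the derivative of the
    constraints being nearly constant near z.  Comparing the maximum with
    such points through the mean value theorem, applied once or twice,
    gives D_w f = 0 and D_w D_w L <= 0.

    The multiplier need not be differentiated to justify the second
    identity.  For a fixed p with J p^T = 0 at the base point, the products
    lam_k(b) * (p . grad g^k)(b) have a second factor that vanishes at the base
    point, and such a product is differentiable as soon as lam_k is
    continuous ([is_derive_mul_vanish]).  Continuity of lam comes from
    Cramer's rule ([cvg_row_solution]). *)

Set Implicit Arguments.
Unset Strict Implicit.
Unset Printing Implicit Defensive.

Local Open Scope classical_set_scope.
Local Open Scope ring_scope.

(** * Calculus along lines and symmetry of second derivatives *)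

Section Calculus.
Variables (R : realType) (V : normedModType R).
Implicit Types (h : V -> R) (y z d u v : V).

Lemma is_derive_line h y d (s : R) : derivable h (y + s *: d) d ->
  is_derive s 1 (fun t : R => h (y + t *: d)) ('D_d h (y + s *: d)).
Proof.
have E : (fun k : R => k^-1 *: (((fun t : R => h (y + t *: d)) \o shift s) (k *: 1)
           - h (y + s *: d))) =
         (fun k => k^-1 *: ((h \o shift (y + s *: d)) (k *: d) - h (y + s *: d))).
  apply/funext => k /=; congr (_ *: (h _ - _)).
  by rewrite [k *: 1]mulr1 scalerDl addrCA.
by move=> dh; split; rewrite /derivable /derive E.
Qed.

Lemma MVT_line h y d (t : R) : 0 < t ->
  (forall s, 0 <= s <= t -> derivable h (y + s *: d) d) ->
  exists2 s, 0 < s < t & h (y + t *: d) - h y = t * 'D_d h (y + s *: d).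
Proof.
move=> t0 dh.
have dphi s : 0 <= s <= t ->
    is_derive s 1 (fun t : R => h (y + t *: d)) ('D_d h (y + s *: d)).
  by move=> ?; apply: is_derive_line; exact: dh.
have [||s st] := @MVT R (fun s => h (y + s *: d))
    (fun s => 'D_d h (y + s *: d)) 0 t t0.
- by move=> s /[!in_itv]/= /andP[s0 st]; apply: dphi; rewrite !ltW.
- apply: derivable_within_continuous => s /[!in_itv]/= st.
  by have [] := dphi s st.
rewrite scale0r addr0 subr0 mulrC => E; exists s => //.
Qed.

(** The second difference over the parallelogram spanned by t u and t v is
    the increment along t u of k(z) = h(z + t v) - h(z).  The mean value
    theorem turns it into an increment of 'D_u h along t v, and a second
    application finishes.  The left-hand side is symmetric in u and v, which
    is what makes mixed derivatives commute. *)
Lemma second_difference h y u v (t : R) : 0 < t ->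
  (forall r s, 0 <= r <= t -> 0 <= s <= t ->
     differentiable h (y + r *: u + s *: v) /\
     derivable ('D_u h) (y + r *: u + s *: v) v) ->
  exists r s, [/\ 0 <= r <= t, 0 <= s <= t &
    h (y + t *: u + t *: v) - h (y + t *: u) - h (y + t *: v) + h y =
    t ^+ 2 * 'D_v ('D_u h) (y + r *: u + s *: v)].
Proof.
move=> t0 dh.
have t0t : 0 <= t <= t by rewrite lexx ltW.
have t00 : 0 <= (0 : R) <= t by rewrite lexx ltW.
have dlo s : 0 <= s <= t -> differentiable h (y + s *: u).
  by move=> st; have [] := dh s 0 st t00; rewrite scale0r addr0.
have dhi s : 0 <= s <= t -> differentiable h (y + t *: v + s *: u).
  by move=> st; have [] := dh s t st t0t; rewrite addrAC.
pose k := h \o shift (t *: v) - h.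
have kE z : k z = h (z + t *: v) - h z by [].
have dk s : 0 <= s <= t -> is_derive (y + s *: u) u k
    ('D_u h (y + t *: v + s *: u) - 'D_u h (y + s *: u)).
  move=> st; apply: is_deriveB; last first.
    by apply: derivableP; apply: diff_derivable; exact: dlo.
  have E : (fun l : R => l^-1 *: (((h \o shift (t *: v)) \o shift (y + s *: u)) (l *: u)
        - (h \o shift (t *: v)) (y + s *: u))) =
      (fun l => l^-1 *: ((h \o shift (y + t *: v + s *: u)) (l *: u)
        - h (y + t *: v + s *: u))).
    apply/funext => l /=; congr (_ *: (h _ - h _)); last by rewrite addrAC.
    by rewrite -addrA; congr (_ + _); rewrite addrAC.
  by split; rewrite /derivable /derive E//; apply: diff_derivable; exact: dhi.
have [|r /andP[r0 rt]] := @MVT_line k y u t t0.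
  by move=> s st; have [] := dk s st.
have rt' : 0 <= r <= t by rewrite !ltW.
have [_ ->] := dk r rt'.
rewrite !kE => Er.
have [|s /andP[s0 st]] := @MVT_line ('D_u h) (y + r *: u) v t t0.
  by move=> s st; have [] := dh r s rt' st.
rewrite [y + t *: v + _]addrAC in Er => Es.
exists r, s; split => //; first by rewrite !ltW.
rewrite expr2 -mulrA -Es -Er; ring.
Qed.

Lemma near_square y u v (Q : set V) : nbhs y Q ->
  exists2 t : R, 0 < t & forall r s, 0 <= r <= t -> 0 <= s <= t ->
    Q (y + r *: u + s *: v).
Proof.
move=> /nbhs_normP[/= e e0 eQ].
pose t := e / 2 / (1 + `|u| + `|v|).
have N0 : 0 < 1 + `|u| + `|v| by rewrite -addrA ltr_pwDl.
have t0 : 0 < t by rewrite !divr_gt0.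
exists t => // r s /andP[r0 rt] /andP[s0 st]; apply: eQ => /=.
rewrite /ball_/= -addrA opprD addNKr normrN.
apply: le_lt_trans (ler_normD _ _) _; rewrite !normrZ (ger0_norm r0) (ger0_norm s0).
apply: (@le_lt_trans _ _ (t * (1 + `|u| + `|v|))).
  rewrite !mulrDr -addrA mulr1 ler_wpDl ?(ltW t0)//.
  by rewrite lerD// ler_wpM2r.
by rewrite divfK ?gt_eqF// gtr_pMr// invf_lt1// ltr1n.
Qed.

(** Over parallelograms shrinking to z, both mixed derivatives are squeezed
    onto the same second difference divided by t^2. *)
Lemma Schwarz (A : set V) h z u v : open A -> C2_on A h -> A z ->
  'D_u ('D_v h) z = 'D_v ('D_u h) z.
Proof.
move=> oA [C1h C2h] Az; apply/eqP; rewrite -subr_eq0 -normr_le0.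
apply/ler_addgt0Pr => e e0; rewrite add0r.
have e2 : 0 < e / 2 by rewrite divr_gt0.
have [_ /(_ u) cvu] := C2h v z Az; have [_ /(_ v) cuv] := C2h u z Az.
have nA : nbhs z A by exact: open_nbhs_nbhs.
have [t t0 Qt] := near_square u v (filterI nA (filterI
  ((cvgrPdist_lt _ _).1 cvu _ e2) ((cvgrPdist_lt _ _).1 cuv _ e2))).
have regular d d' y : A y -> differentiable h y /\ derivable ('D_d h) y d'.
  move=> Ay; split; first exact: (C1h _ Ay).1.
  exact/diff_derivable/(C2h d _ Ay).1.
have [|r [s [rt st]]] := @second_difference h z u v t t0.
  by move=> r s rt st; apply: regular; exact: (Qt r s rt st).1.
have [|r' [s' [rt' st']]] := @second_difference h z v u t t0.
  by move=> p q pt qt; rewrite addrAC; apply: regular; exact: (Qt q p qt pt).1.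
rewrite [z + r' *: v + _]addrAC [z + t *: v + _]addrAC => E1 E2.
have t2 : t ^+ 2 != 0 by rewrite sqrf_eq0 gt_eqF.
have E : 'D_u ('D_v h) (z + s' *: u + r' *: v) = 'D_v ('D_u h) (z + r *: u + s *: v).
  apply: (mulfI t2); apply: etrans (esym E1) (etrans _ E2).
  by rewrite [X in X + _ = _]addrAC.
have [_ /= [H1 _]] := Qt s' r' st' rt'; have [_ /= [_ H2]] := Qt r s rt st.
move: E H1 H2.
move: ('D_u _ (z + _ + _)) ('D_v _ (z + _ + _)) ('D_u _ z) ('D_v _ z).
move=> a _ b c <- H1 H2; apply: le_trans (ler_distD a _ _) _.
by rewrite [leRHS]splitr lerD// ltW// distrC.
Qed.

End Calculus.

(** * Derivatives of functions of a row vector *)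

Lemma mx_norm_entry (R : realType) m n (A : 'M[R]_(m, n)) i j :
  `|A i j| <= `|A|.
Proof. by rewrite [leRHS]/Num.Def.normr /= mx_normrE (le_bigmax _ _ (i, j)). Qed.

Lemma mx_norm_le (R : realType) m n (A : 'M[R]_(m, n)) (e : R) : 0 <= e ->
  (forall i j, `|A i j| <= e) -> `|A| <= e.
Proof.
by move=> e0 Ae; rewrite /Num.Def.normr /= mx_normrE bigmax_le// => -[i j] _; exact: Ae.
Qed.

Lemma mx_norm_mul (R : realType) m n (u : 'rV[R]_m) (A : 'M[R]_(m, n)) :
  `|u *m A| <= `|u| * (m%:R * `|A|).
Proof.
apply: mx_norm_le => [|i j]; first by rewrite !mulr_ge0.
rewrite mxE; apply: le_trans (ler_norm_sum _ _ _) _.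
apply: (@le_trans _ _ (\sum_(k < m) `|u| * `|A|)).
  by apply: ler_sum => k _; rewrite normrM ler_pM// mx_norm_entry.
by rewrite sumr_const card_ord -[leLHS]mulr_natl mulrCA.
Qed.

Lemma near_fst (T U : topologicalType) (z : T) (w : U) (P : set T) :
  nbhs z P -> \forall p \near (z, w), P p.1.
Proof. exact: cvg_fst. Qed.

Section Rows.
Variables (R : realType) (M : nat).
Local Notation V := ('rV[R]_M).
Implicit Types (h : V -> R) (A : set V).

Lemma derive_row h z d : differentiable h z ->
  'D_d h z = \sum_(i < M) d 0 i * 'D_(delta_mx 0 i) h z.
Proof.
move=> dh; rewrite deriveE// [in LHS](row_sum_delta d) linear_sum.
by apply: eq_bigr => i _; rewrite linearZ/= deriveE.
Qed.

(** Only the outer derivative is linear in its direction at a point; the inner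
    one is brought outside by symmetry, so that the expansion involves
    coordinate functions 'D_(delta_mx 0 i) h that are differentiable near z. *)
Lemma derive2_row h A z d : open A -> C2_on A h -> A z ->
  'D_d ('D_d h) z =
  \sum_(i < M) d 0 i * 'D_d ('D_(delta_mx 0 i) h) z.
Proof.
move=> oA C2h Az; rewrite derive_row; last exact: (C2h.2 d z Az).1.
by apply: eq_bigr => i _; rewrite (Schwarz _ _ oA C2h).
Qed.

(** Joint continuity in the point and the direction lets a strict sign of a
    derivative persist for the perturbed directions that
    [tangent_direction] produces. *)
Lemma cvg_derive h A z d : open A -> C1_on A h -> A z ->
  'D_(p.2) h p.1 @[p --> (z, d)] --> 'D_d h z.
Proof.
move=> oA C1h Az; rewrite derive_row; last exact: (C1h z Az).1.
have nA : \forall p \near (z, d), A p.1.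
  by apply: near_fst; exact: open_nbhs_nbhs.
suff : (fun p : V * V => \sum_(i < M) p.2 0 i * 'D_(delta_mx 0 i) h p.1) @ (z, d) -->
    \sum_(i < M) d 0 i * 'D_(delta_mx 0 i) h z.
  apply: cvg_trans; apply: near_eq_cvg; near=> p.
  rewrite derive_row//; apply: (C1h p.1 _).1; by near: p.
apply: cvg_big => [|i _]; [exact: add_continuous|apply: cvgM].
  apply: (@cvg_comp _ _ _ snd (fun u : V => u 0 i) _ (nbhs d)).
    exact: cvg_snd.
  exact: coord_continuous.
apply: (@cvg_comp _ _ _ fst ('D_(delta_mx 0 i) h) _ (nbhs z)).
  exact: cvg_fst.
exact: (C1h z Az).2.
Unshelve. all: by end_near. Qed.

Lemma cvg_derive2 h A z d : open A -> C2_on A h -> A z ->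
  'D_(p.2) ('D_(p.2) h) p.1 @[p --> (z, d)] --> 'D_d ('D_d h) z.
Proof.
move=> oA C2h Az; rewrite (derive2_row d oA C2h Az).
have nA : \forall p \near (z, d), A p.1.
  by apply: near_fst; exact: open_nbhs_nbhs.
suff : (fun p : V * V => \sum_(i < M) p.2 0 i * 'D_(p.2) ('D_(delta_mx 0 i) h) p.1)
    @ (z, d) --> \sum_(i < M) d 0 i * 'D_d ('D_(delta_mx 0 i) h) z.
  apply: cvg_trans; apply: near_eq_cvg; near=> p.
  by rewrite (derive2_row _ oA C2h)//; near: p.
apply: cvg_big => [|i _]; [exact: add_continuous|apply: cvgM].
  apply: (@cvg_comp _ _ _ snd (fun u : V => u 0 i) _ (nbhs d)).
    exact: cvg_snd.
  exact: coord_continuous.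
exact: cvg_derive oA (C2h.2 _) Az.
Unshelve. all: by end_near. Qed.

(** A bound uniform in both points y and y' is needed to make the map of
    [tangent_direction] a contraction; differentiability at z alone controls
    only increments starting from z. *)
Lemma strict_differentiability h A z (e : R) : open A -> C1_on A h -> A z ->
  0 < e -> exists2 r : R, 0 < r & forall y y',
    `|y - z| < r -> `|y' - z| < r ->
    `|h y - h y' - 'D_(y - y') h z| <= e * `|y - y'|.
Proof.
move=> oA C1h Az e0.
pose e' := e / (M%:R + 1).
have M1 : 0 < M%:R + 1 :> R by rewrite ltr_wpDl.
have e'0 : 0 < e' by rewrite divr_gt0.
have near_D : \forall y \near z, forall i : 'I_M,
    `|'D_(delta_mx 0 i) h z - 'D_(delta_mx 0 i) h y| < e'.
  have cD (i : 'I_M) : \forall y \near z,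
      `|'D_(delta_mx 0 i) h z - 'D_(delta_mx 0 i) h y| < e'.
    exact: ((cvgrPdist_lt _ _).1 ((C1h z Az).2 (delta_mx 0 i)) _ e'0).
  exact: filter_forall cD.
have /nbhs_normP[/= r r0 Hr] : \forall y \near z, A y /\ forall i : 'I_M,
    `|'D_(delta_mx 0 i) h z - 'D_(delta_mx 0 i) h y| < e'.
  exact: filterI (open_nbhs_nbhs (conj oA Az)) near_D.
exists r => // y y' yz y'z.
have seg s : 0 <= s <= 1 -> ball_ Num.norm z r (y' + s *: (y - y')).
  move=> /andP[s0 s1]; rewrite /ball_/= distrC.
  have -> : y' + s *: (y - y') - z = (1 - s) *: (y' - z) + s *: (y - z).
    by apply/rowP => i; rewrite !mxE; ring.
  apply: le_lt_trans (ler_normD _ _) _; rewrite !normrZ.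
  rewrite ger0_norm ?subr_ge0// ger0_norm//.
  have [->|s_neq0] := eqVneq s 0; first by rewrite subr0 mul0r mul1r addr0.
  have {s_neq0} : 0 < s by rewrite lt0r s_neq0.
  nra.
have [|s /andP[s0 s1]] := @MVT_line _ _ h y' (y - y') 1 ltr01.
  move=> s s01; apply: diff_derivable; apply: (C1h _ _).1.
  exact: (Hr _ (seg s s01)).1.
have s01 : 0 <= s <= 1 by rewrite !ltW.
rewrite scale1r subrKC mul1r => ->.
have [As Ds] := Hr _ (seg s s01).
rewrite !derive_row; [|exact: (C1h z Az).1|exact: (C1h _ As).1].
rewrite -sumrB; apply: le_trans (ler_norm_sum _ _ _) _.
apply: (@le_trans _ _ (\sum_(i < M) e' * `|y - y'|)).
  apply: ler_sum => i _; rewrite -mulrBr normrM mulrC ler_pM ?mx_norm_entry//.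
  by rewrite distrC ltW.
rewrite sumr_const card_ord -mulr_natr mulrAC ler_wpM2r// /e' mulrAC.
by rewrite ler_pdivrMr// ler_pM2l// lerDl.
Qed.

End Rows.

(** * Tangent directions of a constraint set *)

(** Row vectors are complete and normed; joining the two structures makes
    the Banach fixed-point theorem applicable to them. *)
HB.instance Definition _ (R : realType) n := Complete.on 'rV[R]_n.

(** The bound on T 0 is what keeps the ball invariant: the
    contraction sends each of its points to within b/2 of T 0. *)
Lemma half_contraction_fixed_point (R : realType) n (T : 'rV[R]_n -> 'rV[R]_n) (b : R) :
  0 <= b ->
  (forall s s', `|s| <= b -> `|s'| <= b -> `|T s - T s'| <= 2^-1 * `|s - s'|) ->
  `|T 0| <= 2^-1 * b ->
  exists2 s, `|s| <= b & T s = s.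
Proof.
move=> b0 LT T0; pose U : set 'rV[R]_n := [set s | `|s| <= b].
have U0 : U 0 by rewrite /U/= normr0.
have TU : {homo T : x / U x >-> U x}.
  move=> s Us; rewrite /U/= -(subrK (T 0) (T s)).
  apply: le_trans (ler_normD _ _) _; have := LT _ _ Us U0; rewrite subr0.
  move: Us; rewrite /U/=; lra.
have [|||s Us] := @banach_fixed_point R 'rV[R]_n U (mkfun_fun TU).
- exists (2^-1)%:nng; split => /=; first by rewrite invf_lt1// ltr1n.
  by move=> [s s'] [/= Us Us']; exact: LT.
- rewrite (_ : U = (Num.norm : 'rV[R]_n -> R) @^-1` [set x | x <= b]) //.
  by apply: closed_comp; [move=> ? _; exact: norm_continuous|exact: closed_le].
- by exists 0.
by move=> /esym /= Ts; exists s.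
Qed.

Section Tangent.
Variables (R : realType) (M K : nat).
Local Notation V := ('rV[R]_M).
Variables (A : set V) (g : 'I_K -> V -> R) (z : V).
Hypotheses (oA : open A) (C1g : forall k, C1_on A (g k)) (Az : A z).

Definition jacobian_rows : 'M[R]_(K, M) :=
  \matrix_(k < K, i < M) 'D_(delta_mx 0 i) (g k) z.

Lemma derive_jacobian d k : 'D_d (g k) z = (d *m jacobian_rows^T) 0 k.
Proof.
rewrite derive_row; last exact: (C1g k Az).1.
by rewrite mxE; apply: eq_bigr => i _; rewrite !mxE.
Qed.

Hypotheses (gz : forall k, g k z = 0) (free_g : row_free jacobian_rows).

(** A Lyusternik-type theorem.  Choose B with B J^T = 1 and try the points
    z + t w + s B: to first order the constraint functions take the value s
    there, because w is tangent.  So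
    s |-> s - g(z + t w + s B) has Lipschitz constant at most 1/2 near the
    origin and maps 0 to a vector of size o(t); its fixed point s has size
    o(t) and gives w' = w + t^-1 s B. *)
Lemma tangent_direction w (e : R) : w *m jacobian_rows^T = 0 -> 0 < e ->
  exists t w', [/\ 0 < t < e, `|w' - w| < e & forall k, g k (z + t *: w') = 0].
Proof.
move=> Jw e0.
have [C GC] := row_freeP free_g; pose B := C^T.
have BG : B *m jacobian_rows^T = 1%:M by rewrite -trmx_mul GC trmx1.
pose c := K%:R * `|B| + 1.
have c0 : 0 < c by rewrite ltr_wpDl// mulr_ge0.
have sB (s : 'rV_K) : `|s *m B| <= `|s| * c.
  by apply: le_trans (mx_norm_mul _ _) _; rewrite ler_wpM2l// lerDl.
clearbody c.
(* A ball of radius rho * t for s moves the direction w by at most e / 2. *)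
pose rho := e / (2 * c).
have rho0 : 0 < rho by rewrite divr_gt0// mulr_gt0.
have w1 : 0 < `|w| + 1 by rewrite ltr_wpDl.
(* The first bound gives the contraction ratio, the second the size of the
   image of 0. *)
pose eps := Num.min (2 * c)^-1 (rho / (2 * (`|w| + 1))).
have c2 : 0 < 2 * c by rewrite mulr_gt0.
have w2 : 0 < 2 * (`|w| + 1) by rewrite mulr_gt0.
have eps0 : 0 < eps by rewrite lt_min invr_gt0 c2 divr_gt0.
have eps_c : eps * c <= 2^-1.
  by rewrite -ler_pdivlMr// -invfM ge_min lexx.
have eps_w : eps * `|w| <= 2^-1 * rho.
  apply: (@le_trans _ _ (eps * (`|w| + 1))); first by rewrite ler_pM2l// lerDl.
  by rewrite -ler_pdivlMr// -mulrA mulrCA -invfM ge_min lexx orbT.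
have near_r : \forall r \near 0^'+, forall k y y', `|y - z| < r -> `|y' - z| < r ->
    `|g k y - g k y' - 'D_(y - y') (g k) z| <= eps * `|y - y'|.
  have near_k k : \forall r \near (0:R)^'+, forall y y', `|y - z| < r -> `|y' - z| < r ->
      `|g k y - g k y' - 'D_(y - y') (g k) z| <= eps * `|y - y'|.
    have [r r0 Hr] := strict_differentiability oA (C1g k) Az eps0.
    near=> r' => y y' yz y'z.
    have rr : r' <= r by near: r'; exact: nbhs_right_le.
    by apply: Hr; [exact: lt_le_trans yz rr|exact: lt_le_trans y'z rr].
  exact: filter_forall near_k.
have : \forall r \near (0 : R)^'+, 0 < r /\ forall k y y', `|y - z| < r -> `|y' - z| < r ->
    `|g k y - g k y' - 'D_(y - y') (g k) z| <= eps * `|y - y'|.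
  by apply: filterI near_r; exact: nbhs_right_gt.
move=> /filter_ex[r [r0 Hr]].
pose m := `|w| + rho * c + 1.
have m0 : 0 < m by rewrite ltr_wpDl// addr_ge0// ltW// mulr_gt0.
pose t := Num.min (e / 2) (r / (2 * m)).
have t0 : 0 < t by rewrite lt_min !divr_gt0// mulr_gt0.
have te : t < e.
  by rewrite gt_min gtr_pMr// invf_lt1// ltr1n.
have tm : t * m < r.
  rewrite -ltr_pdivlMr// gt_min; apply/orP; right.
  by rewrite ltr_pM2l// ltf_pV2 ?posrE ?mulr_gt0// ltr_pMl// ltr1n.
pose F (s : 'rV[R]_K) : 'rV[R]_K := \row_k g k (z + t *: w + s *m B).
have in_ball (s : 'rV[R]_K) : `|s| <= rho * t -> `|z + t *: w + s *m B - z| < r.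
  move=> sb; apply: le_lt_trans tm; rewrite [z + _ + _ - z]addrC addrA addKr.
  apply: le_trans (ler_normD _ _) _; rewrite normrZ (gtr0_norm t0) /m.
  rewrite !mulrDr mulr1 -[leLHS]addr0 lerD ?(ltW t0)// lerD2l.
  apply: le_trans (sB s) _; rewrite mulrA (mulrC t rho).
  by rewrite ler_pM2r.
have [|||s sb Fs] := @half_contraction_fixed_point R K (fun s => s - F s) (rho * t).
- by rewrite ltW// mulr_gt0.
- move=> s s' sb sb'; apply: mx_norm_le => [|i k]; first by rewrite mulr_ge0// invr_ge0.
  rewrite {i}(ord1 i).
  have := Hr k _ _ (in_ball s sb) (in_ball s' sb').
  have -> : z + t *: w + s *m B - (z + t *: w + s' *m B) = (s - s') *m B.
    by rewrite mulmxBl opprD addrACA subrr add0r.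
  rewrite derive_jacobian -mulmxA BG mulmx1 => Hk.
  have -> : (s - F s - (s' - F s')) 0 k =
      - (g k (z + t *: w + s *m B) - g k (z + t *: w + s' *m B) - (s - s') 0 k).
    by rewrite !mxE; ring.
  rewrite normrN; apply: le_trans Hk _.
  apply: le_trans (_ : eps * (`|s - s'| * c) <= _).
    by rewrite ler_pM2l.
  by rewrite mulrCA mulrC ler_wpM2r.
- apply: mx_norm_le => [|i k]; first by rewrite !mulr_ge0 ?invr_ge0// ltW.
  rewrite {i}(ord1 i).
  have z_ball : `|z - z| < r by rewrite subrr normr0.
  have n0 : `|0 : 'rV[R]_K| <= rho * t by rewrite normr0 ltW// mulr_gt0.
  have := Hr k _ _ (in_ball 0 n0) z_ball.
  rewrite mul0mx addr0 [z + _ - z]addrC addKr gz derive_jacobian.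
  rewrite -scalemxAl Jw scaler0 !mxE mul0mx addr0 !subr0 sub0r normrN normrZ (gtr0_norm t0).
  move=> /le_trans; apply; rewrite mulrCA [leRHS]mulrA mulrC.
  by rewrite ler_pM2r.
have F0 k : g k (z + t *: w + s *m B) = 0.
  by move: Fs => /(congr1 (fun u : 'rV_K => u 0 k)); rewrite !mxE; lra.
exists t, (w + t^-1 *: (s *m B)); split=> [||k].
- by rewrite t0 te.
- rewrite addrC addKr normrZ gtr0_norm ?invr_gt0// mulrC ltr_pdivrMr//.
  apply: le_lt_trans (sB s) _.
  apply: (@le_lt_trans _ _ (rho * t * c)); first by rewrite ler_pM2r.
  rewrite mulrAC ltr_pM2r// /rho -mulrA invfM -mulrA mulVf ?gt_eqF// mulr1.
  by rewrite gtr_pMr// invf_lt1// ltr1n.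
- by rewrite scalerDr scalerA divff ?gt_eqF// scale1r addrA F0.
Unshelve. all: by end_near. Qed.

End Tangent.

(** * Necessary conditions for a constrained maximum *)

Definition lagrangian (R : realType) (T : Type) K (f : T -> R) (g : 'I_K -> T -> R)
  (lam : 'rV[R]_K) : T -> R := fun y => f y + \sum_(k < K) lam 0 k * g k y.

Lemma is_derive_lagrangian (R : realType) (V : normedModType R) K (f : V -> R)
    (g : 'I_K -> V -> R) lam y v :
  derivable f y v -> (forall k, derivable (g k) y v) ->
  is_derive y v (lagrangian f g lam)
    (lagrangian ('D_v f) (fun k => 'D_v (g k)) lam y).
Proof.
move=> df dg; have -> : lagrangian f g lam = f + \sum_(k < K) (lam 0 k *: g k).
  by apply/funext => t; rewrite /lagrangian /= fct_sumE.
apply: is_deriveD; first exact: derivableP.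
by apply: is_derive_sum => k; apply: is_deriveZ; exact: derivableP.
Qed.

Section Necessary.
Variables (R : realType) (M K : nat).
Local Notation V := ('rV[R]_M).
Variables (A : set V) (f : V -> R) (g : 'I_K -> V -> R) (z : V).
Hypotheses (oA : open A) (Az : A z).
Hypotheses (C1g : forall k, C1_on A (g k)).
Hypotheses (gz : forall k, g k z = 0) (free_g : row_free (jacobian_rows g z)).

(** The form in which tangent directions are used: a property that holds near
    (z, w) holds, with the perturbed direction w', on a whole segment from z
    to a feasible point, as the mean value theorem requires. *)
Lemma tangent_segment w (Q : set (V * V)) :
  w *m (jacobian_rows g z)^T = 0 -> nbhs (z, w) Q ->
  exists t w', [/\ 0 < t, forall k, g k (z + t *: w') = 0 &
    forall s, 0 <= s <= t -> Q (z + s *: w', w')].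
Proof.
move=> Jw /nbhs_normP[/= e e0 eQ].
have we : 0 < `|w| + e by rewrite ltr_wpDl.
have e'0 : 0 < Num.min e (e / (`|w| + e)) by rewrite lt_min e0 divr_gt0.
have [t [w' [/andP[t0 +] + gt]]] := tangent_direction oA C1g Az gz free_g Jw e'0.
rewrite !lt_min ltr_pdivlMr// => /andP[_ te] /andP[we' _].
exists t, w'; split => // s /andP[s0 st]; apply: eQ.
rewrite /ball_/= -[X in X < _]/(Num.max `|z - (z + s *: w')| `|w - w'|).
rewrite gt_max (distrC w w') we' andbT opprD addNKr normrN normrZ ger0_norm//.
apply: le_lt_trans te; apply: ler_pM => //.
rewrite -(subrK w w') addrC; apply: le_trans (ler_normD _ _) _.
by rewrite lerD2l ltW.
Qed.

Hypothesis fmax : \forall y \near z, (forall k, g k y = 0) -> f y <= f z.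

(** If 'D_w f z were positive, it would stay positive along a segment leading
    to a feasible point, where f would exceed its maximum; the opposite
    direction is tangent too. *)
Lemma first_order_condition w : C1_on A f ->
  w *m (jacobian_rows g z)^T = 0 -> 'D_w f z = 0.
Proof.
move=> C1f.
suff le0 u : u *m (jacobian_rows g z)^T = 0 -> 'D_u f z <= 0.
  move=> Jw; apply/eqP; rewrite eq_le le0//=.
  have := le0 (- w); rewrite mulNmx Jw oppr0 => /(_ erefl).
  by rewrite !deriveE ?linearN ?oppr_le0//; exact: (C1f z Az).1.
move=> Ju; rewrite leNgt; apply/negP => D0.
have nQ : \forall p \near (z, u), [/\ A p.1,
    (forall k, g k p.1 = 0) -> f p.1 <= f z & 0 < 'D_(p.2) f p.1].
  near=> p; split; near: p.
  - by apply: near_fst; exact: open_nbhs_nbhs.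
  - exact: near_fst fmax.
  - exact: (cvgr_gt _ (cvg_derive oA C1f Az) _ D0).
have [t [w' [t0 gt Qt]]] := tangent_segment Ju nQ.
have tt : 0 <= t <= t by rewrite lexx ltW.
have [|s /andP[s0 st] E] := @MVT_line _ _ f z w' t t0.
  by move=> s /Qt[/= As _ _]; apply: diff_derivable; exact: (C1f _ As).1.
have [_ /= /(_ gt) + _] := Qt t tt.
have [|_ _ /= Ds] := Qt s; first by rewrite !ltW.
by rewrite -subr_le0 E leNgt mulr_gt0.
Unshelve. all: by end_near. Qed.

(** The gradient of f annihilates the kernel of J, hence lies in its row
    space. *)
Lemma lagrange_multiplier : C1_on A f ->
  exists lam : 'rV[R]_K, forall v,
    'D_v f z + \sum_(k < K) lam 0 k * 'D_v (g k) z = 0.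
Proof.
move=> C1f; pose d : 'rV[R]_M := \row_i 'D_(delta_mx 0 i) f z.
have Dd v : 'D_v f z = (v *m d^T) 0 0.
  rewrite derive_row; last exact: (C1f z Az).1.
  by rewrite mxE; apply: eq_bigr => i _; rewrite !mxE.
have : (d <= jacobian_rows g z)%MS.
  rewrite submxE; apply/eqP/rowP => i; rewrite [RHS]mxE.
  pose w : 'rV_M := (col i (cokermx (jacobian_rows g z)))^T.
  have : 'D_w f z = 0.
    apply: first_order_condition => //.
    by rewrite -trmx_mul colE mulmxA mulmx_coker mul0mx trmx0.
  by rewrite Dd -trmx_mul mxE colE mulmxA -colE mxE.
move=> /submxP[lam dE]; exists (- lam) => v.
rewrite Dd dE trmx_mul mulmxA mxE.
rewrite -big_split/= big1// => k _.
rewrite (derive_jacobian C1g Az) [lam^T _ _]mxE [(- lam) 0 k]mxE.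
by rewrite mulNr mulrC subrr.
Qed.

(** On feasible points the Lagrange function L agrees with f.  If
    'D_w ('D_w L) z were positive, it would stay so along a segment to a
    feasible point; the derivative of L, zero at z, would be positive on that
    segment and L would increase. *)
Lemma second_order_condition (lam : 'rV[R]_K) w : C2_on A f -> (forall k, C2_on A (g k)) ->
  (forall v, 'D_v f z + \sum_(k < K) lam 0 k * 'D_v (g k) z = 0) ->
  w *m (jacobian_rows g z)^T = 0 ->
  'D_w ('D_w f) z + \sum_(k < K) lam 0 k * 'D_w ('D_w (g k)) z <= 0.
Proof.
move=> C2f C2g stat Jw; rewrite leNgt; apply/negP => D0.
pose L := lagrangian f g lam.
pose L1 v := lagrangian ('D_v f) (fun k => 'D_v (g k)) lam.
pose L2 v := lagrangian ('D_v ('D_v f)) (fun k => 'D_v ('D_v (g k))) lam.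
have dL v y : A y -> is_derive y v L (L1 v y).
  move=> Ay; apply: is_derive_lagrangian => [|k]; apply: diff_derivable.
    exact: (C2f.1 y Ay).1.
  exact: ((C2g k).1 y Ay).1.
have dL1 v y : A y -> is_derive y v (L1 v) (L2 v y).
  move=> Ay; apply: is_derive_lagrangian => [|k]; apply: diff_derivable.
    exact: (C2f.2 v y Ay).1.
  exact: ((C2g k).2 v y Ay).1.
have cL2 : L2 p.2 p.1 @[p --> (z, w)] --> L2 w z.
  rewrite /L2 /lagrangian; apply: cvgD; first exact: cvg_derive2 oA C2f Az.
  apply: cvg_big => [|k _]; first exact: add_continuous.
  by apply: cvgM; [exact: cvg_cst|exact: cvg_derive2 oA (C2g k) Az].
have nQ : \forall p \near (z, w), [/\ A p.1,
    (forall k, g k p.1 = 0) -> f p.1 <= f z & 0 < L2 p.2 p.1].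
  near=> p; split; near: p.
  - by apply: near_fst; exact: open_nbhs_nbhs.
  - exact: near_fst fmax.
  - exact: (cvgr_gt _ cL2 _ D0).
have [t [w' [t0 gt Qt]]] := tangent_segment Jw nQ.
have tt : 0 <= t <= t by rewrite lexx ltW.
have [|s /andP[s0 st]] := @MVT_line _ _ L z w' t t0.
  by move=> s /Qt[/= As _ _]; have [] := dL w' _ As.
have [|/= As _ _] := Qt s; first by rewrite !ltW.
have [_ ->] := dL w' _ As.
have [|r /andP[r0 rs]] := @MVT_line _ _ (L1 w') z w' s s0.
  move=> r /andP[r0 rs]; have [|/= Ar _ _] := Qt r.
    by rewrite r0 (le_trans rs)// ltW.
  by have [] := dL1 w' _ Ar.
have [|/= Ar _ L2r] := Qt r; first by rewrite !ltW// (lt_trans rs).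
have [_ ->] := dL1 w' _ Ar.
have -> : L1 w' z = 0 by exact: stat.
rewrite subr0 => -> E.
have [_ /= /(_ gt) + _] := Qt t tt.
have -> : f (z + t *: w') = L (z + t *: w').
  by rewrite /L /lagrangian big1 ?addr0// => k _; rewrite gt mulr0.
have -> : f z = L z.
  by rewrite /L /lagrangian big1 ?addr0// => k _; rewrite gz mulr0.
by rewrite -subr_le0 E leNgt !mulr_gt0.
Unshelve. all: by end_near. Qed.

End Necessary.

(** * Linear algebra of the comparative statics matrix *)

Lemma row_sqr_eq0 (F : realFieldType) n (u : 'rV[F]_n) : u *m u^T = 0 -> u = 0.
Proof.
move=> /matrixP/(_ 0 0); rewrite !mxE => /eqP.
rewrite psumr_eq0 => [/allP u0|i _]; last by rewrite mxE -expr2 sqr_ge0.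
apply/rowP => i; rewrite mxE; apply/eqP.
by have := u0 i (mem_index_enum _); rewrite mxE mulf_eq0 orbb.
Qed.

Lemma row_free_Gram_unit (F : realFieldType) m n (J : 'M[F]_(m, n)) :
  row_free J -> J *m J^T \in unitmx.
Proof.
move=> freeJ; rewrite -row_free_unit -kermx_eq0; apply/rowV0P => u.
move=> /sub_kermxP; rewrite mulmxA => uJJ.
apply: (row_free_inj freeJ); rewrite mul0mx; apply: row_sqr_eq0.
by rewrite trmx_mul mulmxA uJJ mul0mx.
Qed.

(** S = 1 - Q is the orthogonal projection onto the kernel of J.  The
    hypotheses give Ja = - J X and S B = - S H X, which collapse U to
    - X^T S H S X; symmetry, sign and rank are read off this product.  In the
    application H, B, Ja and X are L_xx, L_xa and the parameter derivatives
    of the constraints and of the solution. *)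
Lemma comparative_statics_algebra (R : realType) K M N (J : 'M[R]_(K, M))
    (Ja : 'M[R]_(K, N)) (X B : 'M[R]_(M, N)) (H : 'M[R]_M) :
  row_free J -> H^T = H ->
  J *m X + Ja = 0 ->
  (forall p : 'rV_M, p *m J^T = 0 -> p *m (H *m X + B) = 0) ->
  (forall w : 'rV_M, w *m J^T = 0 -> (w *m H *m w^T) 0 0 <= 0) ->
  let Q := J^T *m invmx (J *m J^T) *m J in
  let U := X^T *m (1%:M - Q) *m (B - H *m (J^T *m invmx (J *m J^T) *m Ja)) in
  psdmx U /\ (\rank U <= minn (M - K) N)%N.
Proof.
move=> freeJ symH constr statH negH Q U.
have uG := row_free_Gram_unit freeJ.
set S := 1%:M - Q.
have SJ : S *m J^T = 0.
  by rewrite mulmxBl mul1mx -mulmxA mulmxKV ?subrr// -mulmxA.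
have symG : (invmx (J *m J^T))^T = invmx (J *m J^T).
  by rewrite trmx_inv trmx_mul trmxK.
have symS : S^T = S.
  by rewrite /S linearB/= trmx1 !trmx_mul trmxK symG mulmxA.
have SB : S *m B = - (S *m H *m X).
  apply/eqP; rewrite -addr_eq0 addrC -mulmxA -mulmxDr; apply/eqP/row_matrixP => i.
  by rewrite row_mul statH ?row0// -row_mul SJ row0.
have JaE : Ja = - (J *m X) by apply/eqP; rewrite -addr_eq0 addrC constr.
have UE : U = - (X^T *m S *m H *m S *m X).
  have JaQ : J^T *m invmx (J *m J^T) *m Ja = - (Q *m X).
    by rewrite JaE mulmxN !mulmxA.
  have SX : S *m X = X - Q *m X by rewrite mulmxBl mul1mx.
  have inner : S *m (B - H *m (J^T *m invmx (J *m J^T) *m Ja)) =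
      - (S *m H *m (S *m X)).
    by rewrite JaQ mulmxBr SB SX !mulmxN opprK mulmxBr opprB addrC (mulmxA S H).
  by rewrite /U -(mulmxA X^T) inner mulmxN !mulmxA.
split; first split.
- by rewrite UE linearN/= !trmx_mul trmxK symS symH !mulmxA.
- move=> v; pose w := v *m X^T *m S.
  have -> : v *m U *m v^T = - (w *m H *m w^T).
    by rewrite UE /w !trmx_mul trmxK symS mulmxN mulNmx !mulmxA.
  by rewrite mxE oppr_ge0 negH// /w -mulmxA SJ mulmx0.
rewrite leq_min rank_leq_row andbT.
have rS : (\rank S <= M - K)%N.
  have := mulmx0_rank_max SJ; rewrite mxrank_tr (eqP freeJ) => SK.
  by rewrite leq_subRL 1?addnC// (leq_trans (leq_addl _ _) SK).
rewrite UE mxrank_opp; apply: leq_trans (mxrankM_maxl _ _) _.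
apply: leq_trans (mxrankM_maxl _ _) _; apply: leq_trans (mxrankM_maxl _ _) _.
exact: leq_trans (mxrankM_maxr _ _) _.
Qed.

(** * Continuity of solutions of linear systems, and products with a vanishing factor *)

Section Parametric.
Variables (R : realType).

Lemma cvg_det (T : Type) (F : set_system T) n (A : T -> 'M[R]_n) (B : 'M[R]_n) :
  Filter F -> (forall i j, A t i j @[t --> F] --> B i j) ->
  \det (A t) @[t --> F] --> \det B.
Proof.
move=> FF AB; rewrite /determinant.
apply: cvg_big => [|s _]; first exact: add_continuous.
apply: cvgM; first exact: cvg_cst.
by apply: cvg_big => [|i _]; [exact: mul_continuous|exact: AB].
Qed.

(** Cramer's rule writes l as a quotient of polynomials in the entries of A
    and c, with a denominator that does not vanish at a. *)
Lemma cvg_row_solution (T : topologicalType) n (a : T) (A : T -> 'M[R]_n)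
    (c l : T -> 'rV[R]_n) :
  (forall i j, {for a, continuous (fun t => A t i j)}) ->
  (forall j, {for a, continuous (fun t => c t 0 j)}) ->
  A a \in unitmx -> (\forall t \near a, l t *m A t = c t) ->
  forall j, {for a, continuous (fun t => l t 0 j)}.
Proof.
move=> cA cc ua lA j.
have cdet : \det (A t) @[t --> a] --> \det (A a) by exact: cvg_det.
have cadj i k : \adj (A t) i k @[t --> a] --> \adj (A a) i k.
  under eq_cvg do rewrite mxE; rewrite mxE.
  apply: cvgM; first exact: cvg_cst.
  apply: cvg_det => i' j'; under eq_cvg do rewrite !mxE; rewrite !mxE.
  exact: cA.
have det0 : \det (A a) != 0 by move: ua; rewrite unitmxE unitfE.
pose s t := (c t *m \adj (A t)) 0 j / \det (A t).
have sE t : l t *m A t = c t -> \det (A t) != 0 -> s t = l t 0 j.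
  rewrite /s => <- d0; rewrite -mulmxA mul_mx_adj mul_mx_scalar mxE.
  by rewrite mulrAC mulfV// mul1r.
have : s @ a --> s a.
  apply: cvgM; last exact: cvgV.
  rewrite mxE; under eq_cvg do rewrite mxE.
  by apply: cvg_big => [|i _]; [exact: add_continuous|apply: cvgM; [exact: cc|exact: cadj]].
rewrite sE//; last exact: nbhs_singleton lA.
apply: cvg_trans; apply: near_eq_cvg; near=> t; rewrite sE//.
  by near: t.
near: t; exact: (cvgr_neq0 _ cdet det0).
Unshelve. all: by end_near. Qed.

(** As G vanishes at a, the difference quotient of l * G is that of G
    multiplied by values of l close to a: continuity of l is enough. *)
Lemma is_derive_mul_vanish (V : normedModType R) (l G : V -> R) a v :
  {for a, continuous l} -> derivable G a v -> G a = 0 ->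
  is_derive a v (fun b => l b * G b) (l a * 'D_v G a).
Proof.
move=> cl dG Ga.
have : (fun h => h^-1 *: (((fun b => l b * G b) \o shift a) (h *: v) - l a * G a)) @ 0^'
   --> l a * 'D_v G a.
  have -> : (fun h => h^-1 *: (((fun b => l b * G b) \o shift a) (h *: v) - l a * G a)) =
     (fun h => l (h *: v + a) * (h^-1 *: ((G \o shift a) (h *: v) - G a))).
    by apply/funext => h /=; rewrite Ga mulr0 !subr0 /GRing.scale/= mulrCA.
  apply: cvgM; last exact: dG.
  apply: (@cvg_comp _ _ _ (fun h : R => h *: v + a) l _ (nbhs a)); last exact: cl.
  suff : (h *: v + a) @[h --> 0^'] --> 0 *: v + a by rewrite scale0r add0r.
  apply: cvgD; last exact: cvg_cst.
  by apply: cvgZr_tmp; exact: cvg_within.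
by move=> H; split; [apply/cvg_ex; eexists; exact: H|exact: cvg_lim H].
Qed.

End Parametric.

(** * Freezing the parameter and differentiating along the solution *)

Section Slices.
Variables (R : realType) (V W : normedModType R).
Implicit Types (A : set (V * W)) (h : V * W -> R).

Definition slice h a : V -> R := fun y => h (y, a).
Definition slice_set A a : set V := [set y | A (y, a)].

Lemma derive_slice h a v y : 'D_v (slice h a) y = 'D_(v, 0) h (y, a).
Proof.
have E : (fun t : R => t^-1 *: ((slice h a \o shift y) (t *: v) - slice h a y)) =
    (fun t => t^-1 *: ((h \o shift (y, a)) (t *: (v, 0)) - h (y, a))).
  apply/funext => t; congr (_ *: (h _ - _)).
  by congr pair; rewrite /= scaler0 add0r.
by rewrite /derive E.
Qed.

Lemma derive_slice_fun h a v : 'D_v (slice h a) = slice ('D_(v, 0) h) a.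
Proof. by apply/funext => y; rewrite derive_slice. Qed.

Lemma continuous_slice a : continuous ((fun y => (y, a)) : V -> V * W).
Proof. by move=> y; apply: cvg_pair; [exact: cvg_id|exact: cvg_cst]. Qed.

Lemma open_slice A a : open A -> open (slice_set A a).
Proof. by move=> oA; apply: open_comp => // y _; exact: continuous_slice. Qed.

Lemma C1_slice A h a : C1_on A h -> C1_on (slice_set A a) (slice h a).
Proof.
move=> C1h y Ay; have [dh ch] := C1h _ Ay; split.
  by apply: (@differentiable_comp _ _ _ _ (fun y : V => (y, a) : V * W) h) => //.
move=> v; rewrite derive_slice_fun.
apply: (@continuous_comp _ _ _ (fun y : V => (y, a) : V * W) ('D_(v, 0) h)).
  exact: continuous_slice.
exact: ch.
Qed.

Lemma C2_slice A h a : C2_on A h -> C2_on (slice_set A a) (slice h a).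
Proof.
move=> [C1h C2h]; split; first exact: C1_slice.
by move=> v; rewrite derive_slice_fun; exact: C1_slice.
Qed.

End Slices.

Section ChainRule.
Variables (R : realType) (M N : nat).
Local Notation point := ('rV[R]_M * 'rV[R]_N)%type.

Lemma differentiable_along (h : point -> R) (x : 'rV[R]_N -> 'rV[R]_M) a :
  differentiable h (x a, a) -> differentiable x a ->
  differentiable (fun b => h (x b, b)) a.
Proof.
move=> dh dx; apply: (@differentiable_comp _ _ _ _ (fun b => (x b, b)) h) => //.
by apply: (@differentiable_pair _ _ _ _ x id) => //; exact: ex_diff.
Qed.

Lemma is_derive_along (h : point -> R) (x : 'rV[R]_N -> 'rV[R]_M) a (nu : 'I_N) :
  differentiable h (x a, a) -> differentiable x a ->
  is_derive a (delta_mx 0 nu) (fun b => h (x b, b))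
    (\sum_(l < M) d_dx h l (x a, a) * 'D_(delta_mx 0 nu) (fun b => x b 0 l) a
     + d_da h nu (x a, a)).
Proof.
move=> dh dx.
have dxa : differentiable (fun b => (x b, b)) a.
  by apply: (@differentiable_pair _ _ _ _ x id) => //; exact: ex_diff.
have dhx := differentiable_along dh dx.
split; first exact: diff_derivable.
rewrite deriveE//.
rewrite (@diff_comp _ _ _ _ (fun b => (x b, b)) h)//= diff_pair//=.
have -> : 'd id a (delta_mx 0 nu) = delta_mx 0 nu by rewrite diff_val.
rewrite -(deriveE _ dx) derive_mx; last exact: diff_derivable.
set u := \matrix_(i, j) _.
have -> : (u, delta_mx 0 nu) = (\sum_(l < M) u 0 l *: ((delta_mx 0 l, 0) : point))
    + (0, delta_mx 0 nu).
  have -> : \sum_(l < M) u 0 l *: ((delta_mx 0 l, 0) : point) = (u, 0).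
    rewrite [in RHS](row_sum_delta u).
    elim/big_rec2: _ => [//|l p q _ ->].
    by congr pair; rewrite /= scaler0 add0r.
  by congr pair; rewrite /= ?addr0 ?add0r.
rewrite linearD linear_sum/=; congr (_ + _); last by rewrite /d_da deriveE.
by apply: eq_bigr => l _; rewrite linearZ/= /d_dx deriveE// mulrC /u mxE.
Qed.

End ChainRule.

(** * Comparative statics *)

Lemma continuous_combination (R : realType) (T : topologicalType) n (a : T)
    (F : 'I_n -> T -> R) (c : 'I_n -> R) :
  (forall l, {for a, continuous (F l)}) ->
  {for a, continuous (fun b => \sum_(l < n) F l b * c l)}.
Proof.
move=> cF; apply: cvg_big => [|l _]; first exact: add_continuous.
by apply: cvgM; [exact: cF|exact: cvg_cst].
Qed.

(** Collects, with the multipliers held fixed, the derivatives of the gradients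
    of f and of the constraints into those of the Lagrange function. *)
Lemma sum_lagrangian (F : comNzRingType) m n (lam : 'I_n -> F) (p y fa : 'I_m -> F)
    (fx : 'I_m -> 'I_m -> F) (gx : 'I_n -> 'I_m -> 'I_m -> F)
    (ga : 'I_n -> 'I_m -> F) :
  \sum_(i < m) p i * (\sum_(l < m) (fx i l + \sum_(k < n) lam k * gx k i l) * y l
                       + (fa i + \sum_(k < n) lam k * ga k i)) =
  \sum_(i < m) p i * (\sum_(l < m) fx i l * y l + fa i)
  + \sum_(k < n) lam k * (\sum_(i < m) p i * (\sum_(l < m) gx k i l * y l + ga k i)).
Proof.
under [X in _ = _ + X]eq_bigr do rewrite big_distrr/=.
rewrite [X in _ = _ + X]exchange_big -big_split/=; apply: eq_bigr => i _.
under [X in _ = _ + X]eq_bigr do rewrite mulrCA.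
rewrite -big_distrr -mulrDr; congr (_ * _).
under [X in _ = _ + X]eq_bigr do rewrite mulrDr big_distrr/=.
rewrite [X in _ = _ + X]big_split/= [RHS]addrACA.
rewrite [X in _ = (_ + X) + _]exchange_big -big_split/=; congr (_ + _).
apply: eq_bigr => l _; rewrite mulrDl big_distrl/=; congr (_ + _).
by apply: eq_bigr => k _; rewrite mulrA.
Qed.

Section ComparativeStatics.
Variables (R : realType) (M N K : nat).
Local Notation point := ('rV[R]_M * 'rV[R]_N)%type.
Variables (f : point -> R) (g : 'I_K -> point -> R).

Definition L_xx_mx z : 'M[R]_M := \matrix_(i, j) L_xx f g z i j.
Definition L_xa_mx z : 'M[R]_(M, N) := \matrix_(j, nu) L_xa f g z j nu.
Definition param_grad z : 'M[R]_(K, N) := \matrix_(k, nu) d_da (g k) nu z.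
Definition solution_jac (x : 'rV[R]_N -> 'rV[R]_M) a : 'M[R]_(M, N) :=
  \matrix_(l, nu) 'D_(delta_mx 0 nu) (fun b => x b 0 l) a.

Lemma GramE z : Gram g z = constraint_grad g z *m (constraint_grad g z)^T.
Proof. by apply/matrixP => k k'; rewrite !mxE; apply: eq_bigr => i _; rewrite !mxE. Qed.

Lemma QprojE z : Qproj g z =
  (constraint_grad g z)^T *m invmx (Gram g z) *m constraint_grad g z.
Proof.
apply/matrixP => i j; rewrite !mxE exchange_big/=; apply: eq_bigr => k' _.
by rewrite !mxE big_distrl/=; apply: eq_bigr => k _; rewrite !mxE.
Qed.

Lemma UmxE x a (z := (x a, a)) (J := constraint_grad g z) : Umx f g x a =
  (solution_jac x a)^T *m (1%:M - J^T *m invmx (J *m J^T) *m J)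
  *m (L_xa_mx z - L_xx_mx z *m (J^T *m invmx (J *m J^T) *m param_grad z)).
Proof.
rewrite -GramE -QprojE; apply/matrixP => mu nu; rewrite [LHS]mxE [RHS]mxE.
rewrite exchange_big/=; apply: eq_bigr => j _; rewrite [in RHS]mxE big_distrl/=.
apply: eq_bigr => i _; rewrite [(solution_jac x a)^T _ _]mxE [solution_jac x a _ _]mxE.
congr (_ * _); rewrite [RHS]mxE; congr (_ + _); first by rewrite mxE.
rewrite [RHS]mxE; congr (- _).
rewrite [RHS]mxE; apply: eq_bigr => l _; rewrite [L_xx_mx _ _ _]mxE; congr (_ * _).
rewrite exchange_big/= mxE; apply: eq_bigr => k' _.
rewrite mxE [param_grad _ _ _]mxE big_distrl/=; apply: eq_bigr => k _.
by rewrite !mxE.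
Qed.

Variables (P : set 'rV[R]_N) (D : set 'rV[R]_M) (W : set point).
Variable x : 'rV[R]_N -> 'rV[R]_M.
Hypotheses (hP : open P) (hW : open W) (hDPW : D `*` P `<=` W).
Hypotheses (hf : C2_on W f) (hg : forall k, C2_on W (g k)) (hx : C1_on P x).
Hypothesis hint : forall a, P a -> D° (x a).
Hypothesis hsol : forall a, P a -> is_solution f g D a (x a).
Hypothesis hind : forall a, P a -> row_free (constraint_grad g (x a, a)).

Lemma solution_in a : P a -> W (x a, a).
Proof. by move=> Pa; apply: hDPW; split => //=; have [[]] := hsol Pa. Qed.

Lemma jacobian_slice a y :
  jacobian_rows (fun k => slice (g k) a) y = constraint_grad g (y, a).
Proof. by apply/matrixP => k i; rewrite !mxE derive_slice. Qed.

Lemma row_free_slice a : P a ->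
  row_free (jacobian_rows (fun k => slice (g k) a) (x a)).
Proof. by move=> Pa; rewrite jacobian_slice; exact: hind. Qed.

Lemma local_max_slice a : P a -> \forall y \near x a,
  (forall k, slice (g k) a y = 0) -> slice f a y <= slice f a (x a).
Proof.
move=> Pa; have [_ xmax] := hsol Pa.
near=> y => gy; apply: xmax; split => //.
by near: y; exact: hint.
Unshelve. all: by end_near. Qed.

(** Fixing the parameter turns the problem into a maximization over rows, to
    which the multiplier rule applies. *)
Lemma multiplierP a : P a ->
  is_multiplier f g (x a, a) (multiplier f g (x a, a)).
Proof.
move=> Pa; apply: (@getPex _ (is_multiplier f g (x a, a))).
have [lam Hlam] := @lagrange_multiplier R M K (slice_set W a) (slice f a)
  (fun k => slice (g k) a) (x a) (open_slice a hW) (solution_in Pa)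
  (fun k => C1_slice (a := a) (hg k).1) (hsol Pa).1.2
  (row_free_slice Pa) (local_max_slice Pa) (C1_slice (a := a) hf.1).
exists lam => i; rewrite -[RHS](Hlam (delta_mx 0 i)) derive_slice.
by congr (_ + _); apply: eq_bigr => k _; rewrite derive_slice.
Qed.

Lemma L_xx_negative_tangent a (w : 'rV[R]_M) : P a ->
  w *m (constraint_grad g (x a, a))^T = 0 ->
  (w *m L_xx_mx (x a, a) *m w^T) 0 0 <= 0.
Proof.
move=> Pa Jw; set lam := multiplier f g (x a, a).
have hess h : C2_on W h -> 'D_w ('D_w (slice h a)) (x a) =
    \sum_(i < M) \sum_(j < M) w 0 i * w 0 j * d_dx (d_dx h i) j (x a, a).
  move=> C2h; rewrite (derive2_row w (open_slice a hW) (C2_slice a C2h) (solution_in Pa)).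
  apply: eq_bigr => i _; rewrite derive_row; last first.
    exact: ((C2_slice a C2h).2 _ _ (solution_in Pa)).1.
  rewrite big_distrr/=; apply: eq_bigr => j _.
  by rewrite derive_slice_fun derive_slice mulrA.
have -> : (w *m L_xx_mx (x a, a) *m w^T) 0 0 =
    'D_w ('D_w (slice f a)) (x a) +
    \sum_(k < K) lam 0 k * 'D_w ('D_w (slice (g k) a)) (x a).
  transitivity (\sum_(i < M) \sum_(j < M) (w 0 i * w 0 j * d_dx (d_dx f i) j (x a, a)
      + \sum_(k < K) lam 0 k * (w 0 i * w 0 j * d_dx (d_dx (g k) i) j (x a, a)))).
    rewrite mxE exchange_big/=; apply: eq_bigr => j _; rewrite mxE big_distrl/=.
    apply: eq_bigr => i _; rewrite !mxE /L_xx mulrAC mulrDr big_distrr/=.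
    by congr (_ + _); apply: eq_bigr => k _; rewrite mulrCA.
  under eq_bigr => i _ do rewrite big_split/= exchange_big/=.
  rewrite big_split/= (hess _ hf); congr (_ + _).
  rewrite exchange_big/=; apply: eq_bigr => k _.
  rewrite (hess _ (hg k)) big_distrr/=.
  by apply: eq_bigr => i _; rewrite big_distrr.
apply: (@second_order_condition R M K (slice_set W a) (slice f a)
  (fun k => slice (g k) a) (x a) (open_slice a hW) (solution_in Pa)
  (fun k => C1_slice (a := a) (hg k).1) (hsol Pa).1.2
  (row_free_slice Pa)
  (local_max_slice Pa)).
- exact: (C2_slice a hf).
- by move=> k; exact: (C2_slice a (hg k)).
- move=> v.
  have dv h : C2_on W h -> 'D_v (slice h a) (x a) =
      \sum_(i < M) v 0 i * d_dx h i (x a, a).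
    move=> C2h; rewrite derive_row; last exact: ((C2_slice a C2h).1 _ (solution_in Pa)).1.
    by apply: eq_bigr => i _; rewrite derive_slice.
  rewrite (dv _ hf); under [X in _ + X]eq_bigr do rewrite (dv _ (hg _)) big_distrr/=.
  rewrite exchange_big -big_split big1//= => i _.
  under eq_bigr do rewrite mulrCA.
  by rewrite -big_distrr -mulrDr (multiplierP Pa) mulr0.
- by rewrite jacobian_slice.
Qed.

Lemma L_xx_mx_sym a : P a -> (L_xx_mx (x a, a))^T = L_xx_mx (x a, a).
Proof.
move=> Pa; have Wz := solution_in Pa; apply/matrixP => i j; rewrite !mxE /L_xx.
have C h : C2_on W h -> d_dx (d_dx h j) i (x a, a) = d_dx (d_dx h i) j (x a, a).
  move=> C2h.
  exact: (@Schwarz R _ W h (x a, a) (delta_mx 0 i, 0) (delta_mx 0 j, 0) hW C2h Wz).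
apply: (congr2 +%R (C f hf)); apply: eq_bigr => k _.
exact: (congr1 ( *%R _) (C (g k) (hg k))).
Qed.

Lemma constraint_derivative a : P a ->
  constraint_grad g (x a, a) *m solution_jac x a + param_grad (x a, a) = 0.
Proof.
move=> Pa; have Wz := solution_in Pa; apply/matrixP => k nu; rewrite [LHS]mxE [RHS]mxE.
have dg := (is_derive_along nu ((hg k).1 _ Wz).1 (hx Pa).1).
have := @derive_val _ _ _ _ _ _ _ dg.
rewrite (@near_eq_derive _ _ _ _ (cst 0)) ?derive_cst; last first.
  near=> b; have Pb : P b by near: b; exact: open_nbhs_nbhs.
  by have [[_ ->]] := hsol Pb.
move=> ->; rewrite [param_grad _ _ _]mxE; congr (_ + _).
by rewrite mxE; apply: eq_bigr => l _; rewrite !mxE.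
Unshelve. all: by end_near. Qed.

Lemma continuous_along (h : point -> R) a : C1_on W h -> P a ->
  {for a, continuous (fun b => h (x b, b))}.
Proof.
move=> C1h Pa; apply: differentiable_continuous.
exact: (differentiable_along (C1h _ (solution_in Pa)).1 (hx Pa).1).
Qed.

(** Multiplying the first-order condition at b by J(a)^T gives a square
    linear system for the multiplier, whose matrix J(b) J(a)^T is the Gram
    matrix at b = a and so is invertible there. *)
Lemma continuous_multiplier a k : P a ->
  {for a, continuous (fun b => multiplier f g (x b, b) 0 k)}.
Proof.
move=> Pa; set J := constraint_grad g (x a, a).
pose df b : 'rV[R]_M := \row_i d_dx f i (x b, b).
apply: (@cvg_row_solution R _ K a (fun b => constraint_grad g (x b, b) *m J^T)
  (fun b => - df b *m J^T)).
- move=> i j.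
  have -> : (fun b => (constraint_grad g (x b, b) *m J^T) i j) =
      (fun b => \sum_(l < M) d_dx (g i) l (x b, b) * J j l).
    by apply/funext => b; rewrite mxE; apply: eq_bigr => l _; rewrite !mxE.
  by apply: continuous_combination => l; exact: (continuous_along ((hg i).2 _) Pa).
- move=> j.
  have -> : (fun b => (- df b *m J^T) 0 j) =
      (fun b => \sum_(l < M) d_dx f l (x b, b) * - J j l).
    by apply/funext => b; rewrite mxE; apply: eq_bigr => l _; rewrite !mxE mulNr mulrN.
  by apply: continuous_combination => l; exact: (continuous_along (hf.2 _) Pa).
- exact: row_free_Gram_unit (hind Pa).
near=> b; have Pb : P b by near: b; exact: open_nbhs_nbhs.
rewrite mulmxA; congr (_ *m _); apply/rowP => i; rewrite !mxE.
apply/eqP; rewrite -addr_eq0 addrC -[X in _ == X](multiplierP Pb i).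
by apply/eqP; congr (_ + _); apply: eq_bigr => k' _; rewrite mxE.
Unshelve. all: by end_near. Qed.

(** The tangent vector p is frozen at a while b moves: its product with the
    gradient of each constraint vanishes at b = a, so that no
    derivative of the multiplier appears. *)
Lemma stationarity_derivative a (p : 'rV[R]_M) : P a ->
  p *m (constraint_grad g (x a, a))^T = 0 ->
  p *m (L_xx_mx (x a, a) *m solution_jac x a + L_xa_mx (x a, a)) = 0.
Proof.
move=> Pa Jp; have Wz := solution_in Pa; set lam := multiplier f g (x a, a).
apply/rowP => nu; rewrite [RHS]mxE.
pose xnu (l : 'I_M) := 'D_(delta_mx 0 nu) (fun b => x b 0 l) a.
pose F h b := \sum_(i < M) p 0 i * d_dx h i (x b, b).
pose dF h := \sum_(i < M) p 0 i *
  (\sum_(l < M) d_dx (d_dx h i) l (x a, a) * xnu l + d_da (d_dx h i) nu (x a, a)).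
have derF h : C2_on W h -> is_derive a (delta_mx 0 nu) (F h) (dF h).
  move=> C2h; have -> : F h = \sum_(i < M) (p 0 i *: (fun b => d_dx h i (x b, b))).
    by apply/funext => b; rewrite /F fct_sumE.
  apply: is_derive_sum => i; apply: is_deriveZ.
  exact: is_derive_along nu (C2h.2 (delta_mx 0 i, 0) _ Wz).1 (hx Pa).1.
have G0 k : F (g k) a = 0.
  have := congr1 (fun u : 'rV_K => u 0 k) Jp; rewrite !mxE => <-.
  by apply: eq_bigr => i _; rewrite !mxE.
pose S := F f + \sum_(k < K) (fun b => multiplier f g (x b, b) 0 k * F (g k) b).
have dS : is_derive a (delta_mx 0 nu) S (dF f + \sum_(k < K) lam 0 k * dF (g k)).
  apply: is_deriveD; first exact: derF.
  apply: is_derive_sum => k; have [dG <-] := derF _ (hg k).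
  by apply: is_derive_mul_vanish => //; exact: continuous_multiplier.
have : dF f + \sum_(k < K) lam 0 k * dF (g k) = 0.
  rewrite -(@derive_val _ _ _ _ _ _ _ dS) (@near_eq_derive _ _ _ _ (cst 0)).
    by rewrite derive_cst.
  near=> b; have Pb : P b by near: b; exact: open_nbhs_nbhs.
  have -> : S b = F f b + \sum_(k < K) multiplier f g (x b, b) 0 k * F (g k) b.
    by rewrite /S fct_sumE.
  rewrite /F.
  under [X in _ + X]eq_bigr do rewrite big_distrr/=.
  rewrite exchange_big -big_split big1//= => i _.
  under eq_bigr do rewrite mulrCA.
  by rewrite -big_distrr -mulrDr (multiplierP Pb) mulr0.
move=> <-; rewrite -[RHS]sum_lagrangian mxE; apply: eq_bigr => i _; congr (_ * _).
rewrite mxE [L_xa_mx _ _ _]mxE mxE; congr (_ + _).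
by apply: eq_bigr => l _; rewrite [L_xx_mx _ _ _]mxE [solution_jac _ _ _ _]mxE.
Unshelve. all: by end_near. Qed.

End ComparativeStatics.

Theorem theorem3 (R : realType) (M N K : nat)
  (P : set 'rV[R]_N) (D : set 'rV[R]_M) (W : set ('rV[R]_M * 'rV[R]_N)%type)
  (f : 'rV[R]_M * 'rV[R]_N -> R) (g : 'I_K -> 'rV[R]_M * 'rV[R]_N -> R)
  (x : 'rV[R]_N -> 'rV[R]_M)
  (hKM : (K < M)%N) (hKN : (K < N)%N)
  (hP : open P) (hW : open W) (hDPW : D `*` P `<=` W)
  (hf : C2_on W f) (hg : forall k, C2_on W (g k))
  (hx : C1_on P x)
  (hint : forall a, P a -> D° (x a))
  (hsol : forall a, P a -> is_solution f g D a (x a))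
  (huniq : forall a, P a -> forall y, is_solution f g D a y -> y = x a)
  (hind : forall a, P a -> row_free (constraint_grad g (x a, a))) :
  forall a, P a ->
    psdmx (Umx f g x a) /\ (\rank (Umx f g x a) <= minn (M - K) N)%N.
Proof.
move=> a Pa; rewrite UmxE; apply: comparative_statics_algebra.
- exact: hind.
- exact: (L_xx_mx_sym hW hDPW hf hg hsol Pa).
- exact: (constraint_derivative hP hDPW hg hx hsol Pa).
- move=> p; exact: (stationarity_derivative hP hW hDPW hf hg hx hint hsol hind Pa).
- move=> w; exact: (L_xx_negative_tangent hW hDPW hf hg hint hsol hind Pa).
Qed.
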